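(* Let $\Gamma$ be an infinite hyperbolic group, endowed with a left-invariant distance $d$ which is hyperbolic and quasi-isometric to a word distance. Let $\rho_i$ be the uniform probability measure on the ball of radius $i$ around the identity. Then $h(\rho_i)/\ell(\rho_i)\to v$ as $i\to\infty$, where $v$ is the exponential growth rate of balls in $(\Gamma,d)$.
   Context: A hyperbolic group is a finitely generated group that is Gromov-hyperbolic for one (equivalently any) word distance. A (not necessarily geodesic) distance $d$ is hyperbolic if there is $\delta\ge 0$ such that $(y_1|y_3)_{x}\ge \min((y_1|y_2)_{x},(y_2|y_3)_{x})-\delta$ for all points $x,y_1,y_2,y_3$, where $(y|y')_{x}=\frac12[d(x,y)+d(x,y')-d(y,y')]$. ''Quasi-isometric to a word distance'' means that the identity map of $\Gamma$ is a quasi-isometry between $d$ and a word distance. Write $e$ for the identity, $|g|=d(e,g)$, $B_n=\{g\in\Gamma: |g|\le n\}$, and $v=\liminf_{n\to\infty}\frac{\log|B_n|}{n}$, where $|B_n|$ is the cardinality of $B_n$. For a probability measure $\mu$ on $\Gamma$, let $\mu^{*n}$ be its $n$-th convolution power, $L(\mu)=\sum_g\mu(g)|g|$, $H(\mu)=\sum_g\mu(g)(-\log\mu(g))$ (with $0\log 0=0$), $\ell(\mu)=\lim_n L(\mu^{*n})/n$ (drift) and $h(\mu)=\lim_n H(\mu^{*n})/n$ (asymptotic entropy); the limits exist by subadditivity. *)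

(* Defs.v *)
From HB Require Import structures.
From mathcomp Require Import all_boot all_order all_algebra.
From mathcomp Require Import finmap.
From mathcomp Require Import all_classical all_reals all_analysis.
Set Implicit Arguments.
Unset Strict Implicit.
Unset Printing Implicit Defensive.
Import Order.TTheory GRing.Theory Num.Theory.
Import numFieldNormedType.Exports.
Local Open Scope classical_set_scope.
Local Open Scope ring_scope.

Section Distances.
Variables (R : realType) (T : groupType).
Implicit Types (d : T -> T -> R) (S : seq T).

Definition is_distance d : Prop :=
  [/\ forall x y, d x y = 0 <-> x = y,
      forall x y, d x y = d y x &
      forall x y z, d x z <= d x y + d y z].

Definition left_invariant d : Prop :=
  forall g x y, d (g * x)%g (g * y)%g = d x y.

Definition gromov_product d (x y z : T) : R := (d x y + d x z - d y z) / 2.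

Definition gromov_hyperbolic d : Prop :=
  exists2 delta : R, 0 <= delta &
    forall x y1 y2 y3 : T,
      Num.min (gromov_product d x y1 y2) (gromov_product d x y2 y3) - delta
        <= gromov_product d x y1 y3.

Definition represents S (w : seq T) (g : T) : Prop :=
  all (fun s => (s \in S) || (s^-1%g \in S)) w /\ (\prod_(s <- w) s)%g = g.

Definition generates S : Prop := forall g, exists w, represents S w g.

(* When S generates T, the infimum is the minimal length of a word in the
   letters S and their inverses that represents g; otherwise it may be the
   infimum of the empty set, which is 0 by convention. *)
Definition word_norm S (g : T) : R :=
  inf [set (size w)%:R | w in [set w | represents S w g]].

Definition word_dist S (x y : T) : R := word_norm S (x^-1 * y)%g.

(* The identity of T is onto, so being a quasi-isometry reduces to the
   two-sided estimate. *)
Definition quasi_isometric (d1 d2 : T -> T -> R) : Prop :=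
  exists lambda C : R, [/\ 1 <= lambda, 0 <= C &
    forall x y, lambda^-1 * d1 x y - C <= d2 x y /\
                d2 x y <= lambda * d1 x y + C].

Definition quasi_isometric_to_word_dist d : Prop :=
  exists2 S, generates S & quasi_isometric (word_dist S) d.

End Distances.

(* R is the type of real numbers in which word distances take their values. *)
Definition hyperbolic_group (R : realType) (T : groupType) : Prop :=
  exists2 S : seq T, generates S & gromov_hyperbolic (@word_dist R T S).

Section Growth.
Variables (R : realType) (T : groupType) (d : T -> T -> R).

Definition gball (n : nat) : set T := [set g | d 1%g g <= n%:R].

(* fset_set sends infinite sets to the empty set, but balls are finite as soon
   as d is quasi-isometric to a word distance. *)
Definition gball_card (n : nat) : nat := #|` fset_set (gball n)|%fset.

Definition growth_rate : \bar R :=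
  limn_einf (fun n : nat => (ln ((gball_card n)%:R : R) / n%:R)%:E).

Definition unif_ball (n : nat) : T -> R :=
  fun g => if g \in gball n then (gball_card n)%:R^-1 else 0.

End Growth.

(* A probability measure on the (countable) group T is given by its mass
   function T -> R. *)
Section RandomWalk.
Variables (R : realType) (T : groupType).
Implicit Types mu nu : T -> R.

Definition convolution mu nu : T -> R :=
  fun g => fine (\esum_(h in [set: T]) (mu h * nu (h^-1 * g)%g)%:E).

Fixpoint convolution_power mu (n : nat) : T -> R :=
  if n is n'.+1 then convolution mu (convolution_power mu n')
  else fun g => if g == 1%g then 1 else 0.

Definition mean_length (d : T -> T -> R) mu : \bar R :=
  \esum_(g in [set: T]) (mu g * d 1%g g)%:E.

(* The terms are nonnegative since mu g <= 1, so the unordered sum esum is the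
   right one; ln 0 = 0, which realises the convention 0 log 0 = 0. *)
Definition entropy mu : \bar R :=
  \esum_(g in [set: T]) (mu g * - ln (mu g))%:E.

Definition drift (d : T -> T -> R) mu : \bar R :=
  limn (fun n : nat =>
    (mean_length d (convolution_power mu n) * (n%:R^-1)%:E)%E).

Definition asymptotic_entropy mu : \bar R :=
  limn (fun n : nat => (entropy (convolution_power mu n) * (n%:R^-1)%:E)%E).

End RandomWalk.

(* Main.v *)
(* Let B be the ball of radius i, u = log |B| and let W be the law of the walk
   driven by rho_i at time n.

   The bound h <= v l is the Gibbs inequality H(W) <= s L(W) + log Z, where Z is
   the sum of exp(-s |g|) over the support of W: for s > v, growth bounds Z
   linearly in n.

   For the lower bound on h, Jensen gives H(W) >= - log |W|_2^2, and convolution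
   by the indicator of B multiplies the squared l^2 norm by at most a polynomial
   in i times max_(s + t <= i) |B_(s+C)| |B_(t+C)|, hence by at most
   exp((v + o(1)) i) (rapid decay). As log |B| = v i + o(i), this gives
   h >= 2 u - (v + o(1)) i = (v - o(1)) i. Since l <= i, the quotient h / l lies
   between v - o(1) and v.

   Rapid decay and the existence of the growth rate both rest on the fact that
   any z has, at each height t <= |z|, a point close to every g with
   (g | z) >= t. As d need not be geodesic, such points are found on word
   geodesics, by a Morse lemma that bounds the Gromov products along a
   quasi-geodesic. *)
Require Import Defs.
From HB Require Import structures.
From mathcomp Require Import all_boot all_order all_algebra.
From mathcomp Require Import finmap.
From mathcomp Require Import all_classical all_reals all_analysis.
From mathcomp Require Import ring lra zify.
Set Implicit Arguments.
Unset Strict Implicit.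
Unset Printing Implicit Defensive.
Import Order.TTheory GRing.Theory Num.Theory.
Import numFieldNormedType.Exports.
Local Open Scope classical_set_scope.
Local Open Scope ring_scope.

(** * Real sequences *)

Lemma ln_le_subr1 (R : realType) (x : R) : 0 < x -> ln x <= x - 1.
Proof. by move=> x0; have := @le_ln1Dx R (x - 1); rewrite addrCA subrr addr0; apply; lra. Qed.

(** This is [ln y <= y - 1] at [y = e * x]. It absorbs logarithmic errors into linear ones of
    arbitrarily small slope. *)
Lemma ln_le_linear (R : realType) (e : R) : 0 < e ->
  exists2 K : R, 0 <= K & forall x, 0 < x -> ln x <= e * x + K.
Proof.
move=> e0; exists `|ln e| => // x x0.
have := ln_le_subr1 (mulr_gt0 e0 x0); rewrite lnM ?posrE//.
have := ler_norm (- ln e); rewrite normrN; lra.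
Qed.

Lemma up_log2_le_linear (R : realType) (e : R) : 0 < e ->
  exists2 K : R, 0 <= K & forall n, (up_log 2 n)%:R <= e * n%:R + K.
Proof.
move=> e0; have ln20 : 0 < ln (2 : R) by rewrite ln_gt0//; lra.
have [K K0 HK] := ln_le_linear (mulr_gt0 e0 ln20).
have K'0 : 0 <= K / ln 2 + 1 by rewrite addr_ge0// divr_ge0// ltW.
exists (K / ln 2 + 1) => // n.
have [n1|n1] := leqP n 1.
  suff -> : up_log 2 n = 0%N by rewrite addr_ge0// mulr_ge0// ltW.
  by case: n n1 => [|[|n]]//; rewrite ?up_log0 ?up_log1.
have := @up_log_bounds 2 n isT n1 => /andP[lo _].
have u0 : (0 < up_log 2 n)%N by rewrite up_log_gt0.
have : ((up_log 2 n).-1)%:R * ln 2 <= ln (n%:R : R).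
  rewrite mulr_natl -lnXn// ler_ln ?posrE ?exprn_gt0 ?ltr0n//; last by lia.
  by rewrite -natrX ler_nat ltnW.
have := HK n%:R; rewrite ltr0n => /(_ ltac:(lia)) h1 h2.
rewrite -(prednK u0) -natr1 addrA lerD2r -(ler_pM2r ln20) (le_trans h2)//.
by rewrite (le_trans h1)// mulrDl divfK ?gt_eqF//; lra.
Qed.

Lemma cvg_ratio (R : realType) (u : nat -> R) (v : R) :
  (forall e, 0 < e -> exists K, forall n,
     (v - e) * n%:R - K <= u n /\ u n <= (v + e) * n%:R + K) ->
  (fun n => u n / n%:R) @ \oo --> v.
Proof.
move=> H; apply/cvgrPdist_le => e e0.
have [K HK] := H (e / 2) ltac:(lra).
near=> n.
have n0 : 0 < n%:R :> R by rewrite ltr0n; near: n; exists 1%N.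
have nK : 2 * `|K| / e <= n%:R by near: n; apply: nbhs_infty_ger.
have Kn : K <= e / 2 * n%:R.
  rewrite ler_pdivrMr// in nK; have := ler_norm K; lra.
have [lo hi] := HK n.
rewrite distrC ler_distl; apply/andP; split.
  by rewrite ler_pdivlMr//; lra.
by rewrite ler_pdivrMr//; lra.
Unshelve. all: by end_near. Qed.

(** Fekete's lemma, with [v] the infimum of [u n / n]: Euclidean division of [n] by an index where
    the quotient is nearly [v] gives the upper bound. *)
Lemma fekete (R : realType) (u : nat -> R) :
  (forall n, 0 <= u n) -> (forall m n, u (m + n)%N <= u m + u n) ->
  exists v, [/\ 0 <= v, forall n, v * n%:R <= u n &
    forall e, 0 < e -> exists2 K, 0 <= K & forall n, u n <= (v + e) * n%:R + K].
Proof.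
move=> u0 uD; pose S := [set u n.+1 / n.+1%:R | n in [set: nat]].
have S0 : S !=set0 by exists (u 1%N / 1%:R); exists 0%N.
have lbS : lbound S 0 by move=> _ [n _ <-]; rewrite divr_ge0.
have hS : has_inf S by split => //; exists 0.
exists (inf S); split.
- exact: lb_le_inf.
- move=> [|n]; first by rewrite mulr0.
  rewrite -ler_pdivlMr ?ltr0n//; apply: ge_inf; first by exists 0.
  by exists n.
move=> e e0.
have [_ [k _ <-] hk] := inf_adherent e0 hS.
have ukM q r : u (q * k.+1 + r)%N <= q%:R * u k.+1 + u r.
  elim: q => [|q IH]; first by rewrite mul0n add0n mul0r add0r.
  rewrite mulSn -addnA (le_trans (uD _ _))// -natr1; lra.
(* As [u] is nonnegative, this sum dominates [u r] for every possible remainder [r]. *)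
exists (\sum_(r < k.+1) u r); first exact: sumr_ge0.
move=> n; rewrite {1}(divn_eq n k.+1) (le_trans (ukM _ _))//.
apply: lerD; last first.
  rewrite (bigD1 (Ordinal (ltn_pmod n (ltn0Sn k))))//= lerDl.
  exact: sumr_ge0.
have v0 : 0 <= inf S by apply: lb_le_inf.
rewrite ltr_pdivrMr ?ltr0n// in hk.
apply: (@le_trans _ _ ((n %/ k.+1)%:R * ((inf S + e) * k.+1%:R))).
  by rewrite ler_wpM2l// ltW.
rewrite mulrCA -natrM ler_wpM2l//; first lra.
by rewrite ler_nat leq_trunc_div.
Qed.

Lemma le_slope (R : realType) (a b K : R) :
  (forall n : nat, a * n%:R <= b * n%:R + K) -> a <= b.
Proof.
move=> H; rewrite leNgt; apply/negP => ba.
have := H (Num.truncn (K / (a - b))).+1.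
have : K / (a - b) < (Num.truncn (K / (a - b))).+1%:R by apply: truncnS_gt.
by rewrite ltr_pdivrMr ?subr_gt0//; lra.
Qed.

(** * Gromov products along quasi-geodesics *)

(* [lia] is extremely slow when the context contains real inequalities. *)
Ltac nat_lia :=
  repeat match goal with
  | H : is_true (@Order.le _ _ _ _) |- _ => clear H
  | H : is_true (@Order.lt _ _ _ _) |- _ => clear H
  | x := _ |- _ => clearbody x
  end; lia.

Section HyperbolicDistance.
Variables (R : realType) (T : groupType) (d : T -> T -> R) (delta : R).
Hypotheses (d_dist : is_distance d) (delta_ge0 : 0 <= delta).
Hypothesis d_hyp : forall x y1 y2 y3 : T,
  Num.min (gromov_product d x y1 y2) (gromov_product d x y2 y3) - delta
    <= gromov_product d x y1 y3.

Local Notation gp := (gromov_product d).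

Let d_eq0 x : d x x = 0. Proof. by have [H _ _] := d_dist; apply/H. Qed.
Let d_sym x y : d x y = d y x. Proof. by have [_ H _] := d_dist. Qed.
Let d_tri x y z : d x z <= d x y + d y z. Proof. by have [_ _ H] := d_dist. Qed.

Lemma dist_ge0 x y : 0 <= d x y.
Proof. by have := d_tri x y x; rewrite d_eq0 (d_sym y); lra. Qed.

Lemma gromov_productC x y z : gp x y z = gp x z y.
Proof. by rewrite /gromov_product (d_sym y); lra. Qed.

Lemma gromov_product_xx x y : gp x y y = d x y.
Proof. by rewrite /gromov_product d_eq0; lra. Qed.

Lemma gromov_product_ler x y z : gp x y z <= d x z.
Proof. by have := d_tri x z y; rewrite /gromov_product (d_sym z); lra. Qed.

Lemma gromov_product_ge x y z : d x z - d y z <= gp x y z.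
Proof. by have := d_tri x y z; rewrite /gromov_product; lra. Qed.

Lemma gromov_productDl x y z : gp x y z + gp y x z = d x y.
Proof. by rewrite /gromov_product (d_sym y x); lra. Qed.

Lemma hyperbolic_trans c x y1 y2 y3 :
  c <= gp x y1 y2 -> c <= gp x y2 y3 -> c - delta <= gp x y1 y3.
Proof.
move=> c1 c2; apply: le_trans (d_hyp x y1 y2 y3).
by rewrite lerD2r le_min c1.
Qed.

(** Cutting the chain in two halves costs one [delta] per level, so the loss is only logarithmic in
    the number of links. *)
Lemma hyperbolic_chain c x (p : nat -> T) k a n : (0 < n <= 2 ^ k)%N ->
  (forall j, (a <= j < a + n)%N -> c <= gp x (p j) (p j.+1)) ->
  c - k%:R * delta <= gp x (p a) (p (a + n)%N).
Proof.
elim: k a n => [|k IH] a n /andP[n0 nk] H.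
  have -> : n = 1%N by move: nk; rewrite expn0; lia.
  rewrite mul0r subr0 addn1; apply: H; lia.
have kd : 0 <= k%:R * delta by rewrite mulr_ge0.
rewrite -natr1 mulrDl mul1r opprD addrA.
have [n1|n1] := eqVneq n 1%N.
  rewrite n1 addn1; have := H a ltac:(lia); have := delta_ge0; lra.
rewrite expnS in nk.
have [m [m0 mn m1 m2]] : exists m,
    [/\ (0 < m)%N, (m < n)%N, (m <= 2 ^ k)%N & (n - m <= 2 ^ k)%N].
  exists n./2; have := odd_double_half n; rewrite -muln2; move: nk.
  by case: (odd n) => ? ?; split; lia.
have -> : (a + n = a + m + (n - m))%N by lia.
apply: (@hyperbolic_trans _ _ _ (p (a + m)%N)).
  by apply: IH => [|j hj]; [lia|apply: H; lia].
by apply: IH => [|j hj]; [lia|apply: H; lia].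
Qed.

(* In a tree, every path from [x] to [y] crosses the segment [x, y] at each
   height [t]; here, up to an error that is logarithmic in the length. *)
Lemma path_crossing (D t : R) k n (p : nat -> T) :
  0 <= D -> 0 <= t -> t <= d (p 0%N) (p n) -> (n <= 2 ^ k)%N ->
  (forall j, (j < n)%N -> d (p j) (p j.+1) <= D) ->
  exists i, [/\ (i <= n)%N, d (p 0%N) (p i) <= t + D &
    t - k%:R * delta <= gp (p 0%N) (p i) (p n)].
Proof.
move=> D0 t0 td nk hD; set x := p 0%N.
(* The crossing is the first [i] after which every link has product at least [t]. Chaining these
   links bounds the product with [p n]; the link just before [i] has product below [t], which bounds
   the distance to [p i]. *)
pose P i := (i <= n)%N &&
  [forall j : 'I_n, (i <= j)%N ==> (t <= gp x (p j) (p j.+1))].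
have exP : exists i, P i.
  exists n; rewrite /P leqnn /=; apply/forallP => j; apply/implyP.
  by have := ltn_ord j; lia.
have := ex_minnP exP => -[i /andP[ilen /forallP hi] imin]; exists i.
have hi' j : (i <= j < n)%N -> t <= gp x (p j) (p j.+1).
  by move=> /andP[ij jn]; have := hi (Ordinal jn) => /implyP; apply.
have kd : 0 <= k%:R * delta by rewrite mulr_ge0.
split=> //; last first.
  have [->|ni] := eqVneq i n; first by rewrite gromov_product_xx; lra.
  have -> : n = (i + (n - i))%N by lia.
  by apply: hyperbolic_chain => [|j hj]; [lia|apply: hi'; lia].
case: i {hi} ilen imin hi' => [|i] ilen imin hi'; first by rewrite d_eq0; lra.
have : ~~ P i by apply/negP => /imin; lia.
rewrite /P (ltnW ilen) /= => /forallPn[j]; rewrite negb_imply -ltNge.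
move=> /andP[ij gj].
have {}ij : nat_of_ord j = i.
  apply/eqP; rewrite eqn_leq ij andbT leqNgt; apply/negP => ji.
  by have := hi' j; rewrite ji ltn_ord => /(_ isT); lra.
rewrite ij in gj; have := gromov_product_ge x (p i) (p i.+1).
have := hD i ilen; lra.
Qed.

(** * The Morse lemma in terms of Gromov products *)

Section Morse.
Variables lambda C : R.
Hypotheses (lambda_ge1 : 1 <= lambda) (C_ge0 : 0 <= C).

Definition quasi_geodesic (N : nat) (p : nat -> T) : Prop :=
  forall i j, (i <= j <= N)%N ->
    lambda^-1 * (j - i)%:R - C <= d (p i) (p j) /\
    d (p i) (p j) <= lambda * (j - i)%:R + C.

Lemma quasi_geodesic_lengthP N p i j : quasi_geodesic N p -> (i <= j <= N)%N ->
  (j - i)%:R <= lambda * (d (p i) (p j) + C).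
Proof.
move=> qp ij; have [+ _] := qp _ _ ij.
have l0 : 0 < lambda by have := lambda_ge1; lra.
by rewrite lerBlDr mulrC ler_pdivrMr// mulrC.
Qed.

(* Let [z] lie between [x] and [y] on a quasi-geodesic, with [m = (x | y)_z].
   At distance about [2 M] from [z] on both sides, the Gromov product at [z] is
   still about [m], so that crossings at height [m] on both sides of [z] are
   [O(log M)] close, whereas the path between them has length at least of the
   order of [m]. Hence [m] is at most [O(log M)]. *)
Lemma gromov_product_bound_step : exists2 K : R, 0 <= K &
  forall N p M, quasi_geodesic N p -> 0 <= M ->
    (forall a k b, (a <= k <= b)%N -> (b <= N)%N -> gp (p k) (p a) (p b) <= M) ->
    forall a k b, (a <= k <= b)%N -> (b <= N)%N ->
      gp (p k) (p a) (p b) <= M / 2 + K.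
Proof.
have l0 : 0 < lambda by have := lambda_ge1; lra.
have d0 := delta_ge0; have l1 := lambda_ge1; have C0 := C_ge0.
(* The argument ends with [m <= A + B * E], where [E = up_log 2 l] and [l] is about
   [2 * lambda * M]. The slope [e] is chosen so that the part of [B * E] proportional to [M] is at
   most [M / 2]. *)
pose B := delta * (1 + 2 * lambda ^+ 2).
have B0 : 0 <= B by rewrite mulr_ge0// addr_ge0// mulr_ge0// exprn_ge0// ltW.
pose e := (4 * lambda * (B + 1))^-1.
have e0 : 0 < e by rewrite invr_gt0 mulr_gt0 ?mulr_gt0//; lra.
have [Ke Ke0 hlog] := @up_log2_le_linear R e e0.
pose A := 2 * delta + C + lambda ^+ 2 * (2 * (lambda + C) + 4 * delta + C).
have A_ge : 2 * delta <= A.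
  by rewrite /A -addrA lerDl addr_ge0// mulr_ge0 ?exprn_ge0//; lra.
have A0 : 0 <= A by lra.
exists (A + B * (e * (lambda * C + 1) + Ke)).
  rewrite addr_ge0// mulr_ge0// addr_ge0// mulr_ge0 ?(ltW e0)//.
  by rewrite addr_ge0// mulr_ge0// ltW.
move=> N p M qp M0 HM a k b /andP[ak kb] bN.
set z := p k; set m := gp z (p a) (p b).
have mM : m <= M by apply: HM; rewrite ?ak.
(* After [l] steps a quasi-geodesic has moved by at least [2 * M]. *)
have [l l_gt l_le] : exists2 l : nat, lambda * (2 * M + C) <= l%:R &
    l%:R <= lambda * (2 * M + C) + 1.
  have lMC0 : 0 <= lambda * (2 * M + C) by rewrite mulr_ge0//; lra.
  exists (Num.truncn (lambda * (2 * M + C))).+1; first by rewrite ltW// truncnS_gt.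
  by rewrite -natr1 lerD2r truncn_le.
have farM i j : (i <= j <= N)%N -> (j - i)%N = l -> 2 * M <= d (p i) (p j).
  move=> ij ijl; have := quasi_geodesic_lengthP qp ij; rewrite ijl => h.
  have := le_trans l_gt h; rewrite ler_pM2l//; lra.
(* If [a] is more than [l] steps away, take the point [l] steps before [z]: it is at distance at
   least [2 * M] from [z], and the product of [z] and [p a] seen from it is at most [M], so at least
   [M] remains at [z]. *)
have [a' [aa' a'k a'l ga']] : exists a', [/\ (a <= a')%N, (a' <= k)%N,
    (k - a' <= l)%N & m <= gp z (p a') (p a)].
  have [kal|kal] := leqP (k - a) l.
    by exists a; split=> //; rewrite gromov_product_xx /m gromov_productC gromov_product_ler.
  exists (k - l)%N; split; [nat_lia|nat_lia|nat_lia|].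
  have := @farM (k - l)%N k ltac:(nat_lia) ltac:(nat_lia).
  have := @HM a (k - l)%N k ltac:(nat_lia) ltac:(nat_lia).
  have := gromov_productDl z (p (k - l)%N) (p a).
  rewrite -/z (d_sym z) (gromov_productC _ z); lra.
have [b' [bb' b'k b'l gb']] : exists b', [/\ (b' <= b)%N, (k <= b')%N,
    (b' - k <= l)%N & m <= gp z (p b) (p b')].
  have [kbl|kbl] := leqP (b - k) l.
    by exists b; split=> //; rewrite gromov_product_xx gromov_product_ler.
  exists (k + l)%N; split; [nat_lia|nat_lia|nat_lia|].
  have := @farM k (k + l)%N ltac:(nat_lia) ltac:(nat_lia).
  have := @HM k (k + l)%N b ltac:(nat_lia) ltac:(nat_lia).
  have := gromov_productDl z (p (k + l)%N) (p b).
  rewrite -/z (gromov_productC z (p b)); lra.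
have gab : m - 2 * delta <= gp z (p a') (p b').
  have h1 := hyperbolic_trans (lexx m) gb'.
  have h2 : m - delta <= gp z (p a') (p a) by lra.
  have := hyperbolic_trans h2 h1; lra.
set t := m - 2 * delta in gab.
pose E := up_log 2 l.
have E_le : B * E%:R <= M / 2 + B * (e * (lambda * C + 1) + Ke).
  have : E%:R <= e * (lambda * (2 * M + C) + 1) + Ke.
    by rewrite (le_trans (hlog l))// lerD2r ler_wpM2l// ltW.
  move=> /(ler_wpM2l B0) /le_trans; apply.
  have -> : B * (e * (lambda * (2 * M + C) + 1) + Ke) =
    B * (e * lambda * 2) * M + B * (e * (lambda * C + 1) + Ke) by ring.
  rewrite lerD2r mulrC ler_wpM2l//.
  have -> : B * (e * lambda * 2) = B / (2 * (B + 1)).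
    by rewrite /e; field; apply/andP; split; lra.
  by rewrite ler_pdivrMr; lra.
suff : m <= A + B * E%:R by lra.
have BE0 : 0 <= B * E%:R by rewrite mulr_ge0.
have [t0|t0] := ltP t 0; first by rewrite /t in t0; lra.
have lE : (l <= 2 ^ E)%N by apply: up_logP.
have step i : (i < N)%N -> d (p i) (p i.+1) <= lambda + C.
  move=> iN; have [_] := qp i i.+1 ltac:(nat_lia).
  by rewrite subSnn mulr1.
have lC0 : 0 <= lambda + C by lra.
have [j [jl dj gj]] : exists j, [/\ (j <= b' - k)%N, d z (p (k + j)%N) <= t + (lambda + C)
    & t - E%:R * delta <= gp z (p (k + j)%N) (p b')].
  have := @path_crossing (lambda + C) t E (b' - k) (fun j => p (k + j)%N) lC0 t0.
  rewrite addn0 subnKC//; apply; first exact: le_trans gab (gromov_product_ler _ _ _).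
    by nat_lia.
  by move=> j jb; rewrite addnS; apply: step; nat_lia.
have [i [il di gi]] : exists i, [/\ (i <= k - a')%N, d z (p (k - i)%N) <= t + (lambda + C)
    & t - E%:R * delta <= gp z (p (k - i)%N) (p a')].
  have := @path_crossing (lambda + C) t E (k - a') (fun j => p (k - j)%N) lC0 t0.
  rewrite subn0 subKn//; apply.
    by rewrite (le_trans gab)// gromov_productC gromov_product_ler.
    by nat_lia.
  move=> i ia; rewrite d_sym.
  have -> : (k - i = (k - i.+1).+1)%N by nat_lia.
  by apply: step; nat_lia.
have Ed : 0 <= E%:R * delta by rewrite mulr_ge0.
have gij : t - E%:R * delta - 2 * delta <= gp z (p (k - i)%N) (p (k + j)%N).
  have gj' : t - E%:R * delta <= gp z (p b') (p (k + j)%N) by rewrite gromov_productC.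
  have gab' : t - E%:R * delta <= gp z (p a') (p b') by lra.
  have h1 := hyperbolic_trans gab' gj'.
  have h2 : t - E%:R * delta - delta <= gp z (p (k - i)%N) (p a') by lra.
  have := hyperbolic_trans h2 h1; lra.
(* Both crossings are at distance about [t] from [z] and their product at [z] is about [t], so they
   are close. *)
have dij : d (p (k - i)%N) (p (k + j)%N) <= 2 * (lambda + C) + 2 * (E%:R * delta) + 4 * delta.
  by move: gij; rewrite {1}/gromov_product; lra.
have len := @quasi_geodesic_lengthP _ _ (k - i)%N (k + j)%N qp ltac:(nat_lia).
have dzj : t - E%:R * delta <= d z (p (k + j)%N).
  by rewrite (le_trans gj)// gromov_productC gromov_product_ler.
(* The stretch from [z] to the second crossing is part of the short stretch between the crossings,
   yet it covers a distance of about [t]. *)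
have [_ up] := qp k (k + j)%N ltac:(nat_lia).
have jij : lambda * (k + j - k)%:R <= lambda * (k + j - (k - i))%:R.
  by rewrite ler_pM2l// ler_nat; nat_lia.
have : lambda * (k + j - (k - i))%:R <=
    lambda * (lambda * (2 * (lambda + C) + 2 * (E%:R * delta) + 4 * delta + C)).
  rewrite ler_pM2l// (le_trans len)// ler_pM2l//; lra.
rewrite -/z in up; move: up dzj jij.
have -> : A + B * E%:R = 2 * delta + C + E%:R * delta +
  lambda * (lambda * (2 * (lambda + C) + 2 * (E%:R * delta) + 4 * delta + C)).
  by rewrite /A /B; ring.
rewrite /t; lra.
Qed.

(** The map sending [M] to [M / 2 + K] has fixed point [2 * K]. Iterating it from a trivial bound
    depending on [N] ends within 1 of that point, whence a bound independent of [N]. *)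
Lemma quasi_geodesic_gromov_product : exists2 K : R, 0 <= K &
  forall N p, quasi_geodesic N p ->
    forall a k b, (a <= k <= b)%N -> (b <= N)%N -> gp (p k) (p a) (p b) <= K.
Proof.
have [K K0 HK] := gromov_product_bound_step.
exists (2 * K + 1); first lra.
have l1 := lambda_ge1.
move=> N p qp.
pose c := lambda * N%:R + C.
have c0 : 0 <= c by rewrite addr_ge0// mulr_ge0//; lra.
have H n : forall a k b, (a <= k <= b)%N -> (b <= N)%N ->
    gp (p k) (p a) (p b) <= 2 * K + c / 2 ^+ n.
  elim: n => [|n IH] a k b akb bN.
    rewrite expr0 divr1; apply: (le_trans (gromov_product_ler _ _ _)).
    have [_ h] := qp k b ltac:(nat_lia); apply: (le_trans h); rewrite /c.
    have : lambda * (b - k)%:R <= lambda * N%:R.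
      by rewrite ler_pM2l; [rewrite ler_nat; nat_lia|lra].
    lra.
  have M0 : 0 <= 2 * K + c / 2 ^+ n by rewrite addr_ge0// ?divr_ge0 ?exprn_ge0//; lra.
  have := HK N p _ qp M0 IH a k b akb bN.
  rewrite exprS invfM; lra.
move=> a k b akb bN; apply: (le_trans (H (Num.truncn c).+1 _ _ _ akb bN)).
rewrite lerD2l ler_pdivrMr ?exprn_gt0// mul1r.
apply: (@le_trans _ _ (Num.truncn c).+1%:R); first by rewrite ltW// truncnS_gt.
by rewrite -natrX ler_nat ltnW// ltn_expl.
Qed.
End Morse.
End HyperbolicDistance.

(** * Word geodesics and cut points *)

Section WordLength.
Variables (R : realType) (T : groupType).
Implicit Types (S w : seq T) (g h : T).

Lemma represents_cat S w1 w2 g1 g2 : represents S w1 g1 -> represents S w2 g2 ->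
  represents S (w1 ++ w2) (g1 * g2)%g.
Proof. by move=> [a1 <-] [a2 <-]; split; [rewrite all_cat a1|rewrite big_cat]. Qed.

Lemma word_norm_attained S g : generates S -> exists w,
  [/\ represents S w g, word_norm R S g = (size w)%:R &
      forall w', represents S w' g -> (size w <= size w')%N].
Proof.
move=> genS; pose P n := `[< exists2 w, represents S w g & size w = n >].
have exP : exists n, P n.
  by have [w rw] := genS g; exists (size w); apply/asboolP; exists w.
have [n /asboolP[w rw <-] wmin] := ex_minnP exP.
have {}wmin w' : represents S w' g -> (size w <= size w')%N.
  by move=> rw'; apply: wmin; apply/asboolP; exists w'.
exists w; split => //; apply/le_anti/andP; split.
  apply: ge_inf; last by exists w.
  by exists 0 => _ [w' _ <-].
apply: lb_le_inf; first by exists (size w)%:R, w.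
by move=> _ [w' rw' <-]; rewrite ler_nat wmin.
Qed.

(** The points are the prefixes of a shortest word for [g]: a shorter word for a middle block would
    shorten the whole word. *)
Lemma word_geodesic S g : generates S -> exists N (p : nat -> T),
  [/\ p 0%N = 1%g, p N = g & forall i j, (i <= j <= N)%N ->
      word_dist R S (p i) (p j) = (j - i)%:R].
Proof.
move=> genS; have [w [[allw prodw] _ wmin]] := word_norm_attained g genS.
exists (size w), (fun k => (\prod_(s <- take k w) s)%g).
split; [by rewrite take0 big_nil|by rewrite take_size|].
move=> i j /andP[ij jw].
have take_rep k v : all (fun s => (s \in S) || (s^-1%g \in S)) v ->
    represents S (take k v) (\prod_(s <- take k v) s)%g.
  by move=> /allP av; split=> //; apply/allP => x /mem_take /av.
have drop_rep k v : all (fun s => (s \in S) || (s^-1%g \in S)) v ->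
    represents S (drop k v) (\prod_(s <- drop k v) s)%g.
  by move=> /allP av; split=> //; apply/allP => x /mem_drop /av.
set u := drop i (take j w).
have ru : represents S u (\prod_(s <- u) s)%g.
  by apply: drop_rep; have [] := take_rep j w allw.
have su : size u = (j - i)%N by rewrite size_drop size_takel.
have wE : (\prod_(s <- take j w) s = \prod_(s <- take i w) s * \prod_(s <- u) s)%g.
  by rewrite -big_cat /= -[take i w](take_takel _ ij) cat_take_drop.
rewrite /word_dist wE mulKg.
have [w' [rw' -> wmin']] := word_norm_attained (\prod_(s <- u) s)%g genS.
congr (_%:R); apply/eqP; rewrite eqn_leq -{1}su wmin'//=.
have : represents S (take i w ++ w' ++ drop j w) g.
  have := represents_cat (take_rep i w allw) (represents_cat rw' (drop_rep j w allw)).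
  congr (represents _ _ _).
  by rewrite mulgA -wE -big_cat /= cat_take_drop.
move=> /wmin; rewrite !size_cat size_takel ?size_drop; last by lia.
lia.
Qed.

Lemma finite_word_ball S n : generates S ->
  finite_set [set g : T | word_norm R S g <= n%:R].
Proof.
(* The letter [1] pads short words, so that [A k] contains the values of all words of length at most
   [k]. *)
move=> genS; pose L := 1%g :: S ++ [seq s^-1%g | s <- S].
pose A k := iter k (fun X => [seq (x * y)%g | x <- L, y <- X]) [:: 1%g].
have AS k : A k.+1 = [seq (x * y)%g | x <- L, y <- A k] by [].
have HA w k : all (fun s => (s \in S) || (s^-1%g \in S)) w -> (size w <= k)%N ->
    (\prod_(s <- w) s)%g \in A k.
  elim: k w => [|k IH] [|s w] //.
  - by rewrite big_nil mem_seq1.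
  - move=> _ _; rewrite big_nil AS; apply/allpairsP; exists (1%g, 1%g).
    split; rewrite ?mulg1 ?mem_head//=.
    by have := IH [::] isT isT; rewrite big_nil.
  rewrite [all _ _]/= => /andP[sS aw] wk; rewrite big_cons AS; apply/allpairsP.
  exists (s, (\prod_(s <- w) s)%g); split => //=; last exact: IH.
  rewrite /L inE mem_cat; case/orP: sS => sS; first by rewrite sS orbT.
  by rewrite -[s]invgK map_f ?orbT.
apply: (@sub_finite_set _ _ [set` A n]); last exact: finite_seq.
move=> g /=; have [w [[aw <-] -> _]] := word_norm_attained g genS.
by rewrite ler_nat => /(HA _ _ aw).
Qed.
End WordLength.

(** * Finiteness of balls and cut points *)

Section Cut.
Variables (R : realType) (T : groupType) (d : T -> T -> R).
Hypotheses (d_dist : is_distance d) (d_hyp : gromov_hyperbolic d).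
Hypothesis d_qi : quasi_isometric_to_word_dist d.

Local Notation gp := (gromov_product d).

Lemma quasi_isometric_finite_ball n : finite_set (gball d n).
Proof.
have [S genS [lambda [C [l1 C0 H]]]] := d_qi.
have l0 : 0 < lambda by lra.
apply: sub_finite_set (@finite_word_ball R _ S (Num.truncn (lambda * (n%:R + C))).+1 genS).
move=> g /=; rewrite /gball /= => gn.
apply: le_trans (ltW (truncnS_gt _)).
have [+ _] := H 1%g g; rewrite /word_dist invg1 mul1g.
by rewrite lerBlDr mulrC ler_pdivrMr// => /le_trans; apply; rewrite mulrC ler_pM2l// lerD2r.
Qed.

(** Take for [a] the first point at distance at least [t] on a word geodesic from [1] to [z]. The
    Morse lemma gives [(a | z) >= t - K] at [1], and hyperbolicity transfers this to [(a | g)] up to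
    [delta]. *)
Lemma cut_point : exists2 C : R, 0 <= C & forall z t, 0 <= t -> t <= d 1%g z ->
  exists2 a, d 1%g a <= t + C &
    forall g, t <= gp 1%g g z -> d a g <= d 1%g g - t + C.
Proof.
have [delta delta0 hyp] := d_hyp.
have [S genS [lambda [C [l1 C0 H]]]] := d_qi.
have [K K0 morse] := quasi_geodesic_gromov_product d_dist delta0 hyp l1 C0.
have [d_eq0 d_sym d_tri] := d_dist.
exists (lambda + C + 2 * K + 2 * delta); first lra.
move=> z t t0 tz.
have [N [p [p0 pN pd]]] := word_geodesic R z genS.
have qp : quasi_geodesic d lambda C N p.
  by move=> i j ij; have := H (p i) (p j); rewrite pd.
have exP : exists k, (k <= N)%N && (t <= d 1%g (p k)) by exists N; rewrite leqnn pN.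
have [k /andP[kN tk] kmin] := ex_minnP exP.
have dk : d 1%g (p k) <= t + lambda + C.
  case: k kN tk kmin => [|k] kN tk kmin.
    by rewrite p0; have /d_eq0 -> := erefl (1%g : T); lra.
  have [] := qp k k.+1; first by rewrite leqnSn.
  rewrite subSnn mulr1 => _ dk.
  have : d 1%g (p k) < t.
    rewrite ltNge; apply/negP => tk'; have := kmin k.
    by rewrite (ltnW kN) tk' ltnn => /(_ isT).
  have := d_tri 1%g (p k) (p k.+1); lra.
exists (p k); first lra.
move=> g tg.
have := morse N p qp 0%N k N; rewrite leq0n kN p0 pN => /(_ isT (leqnn N)) gK.
have gk : t - K <= gp 1%g (p k) z.
  have := gromov_productDl d_dist 1%g (p k) z; lra.
have gz : t - K <= gp 1%g z g by rewrite gromov_productC//; lra.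
have := hyperbolic_trans hyp gk gz.
rewrite {1}/gromov_product; lra.
Qed.
End Cut.

(** * Growth of balls *)

Section Balls.
Variables (R : realType) (T : groupType) (d : T -> T -> R).
Hypotheses (d_dist : is_distance d) (d_linv : left_invariant d).
Hypothesis ball_finite : forall n, finite_set (gball d n).

Definition ball_seq n : seq T := fset_set (gball d n).

Lemma ball_seq_uniq n : uniq (ball_seq n). Proof. exact: fset_uniq. Qed.

Lemma size_ball_seq n : size (ball_seq n) = gball_card d n. Proof. by []. Qed.

Lemma mem_ball_seq n g : (g \in ball_seq n) = (d 1%g g <= n%:R).
Proof.
rewrite [LHS]in_fset_set; last exact: ball_finite.
by apply/idP/idP; rewrite inE.
Qed.

Lemma one_ball_seq n : 1%g \in ball_seq n.
Proof. by rewrite mem_ball_seq; have [H _ _] := d_dist; rewrite (H 1%g 1%g).2. Qed.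

Lemma gball_card_gt0 n : (0 < gball_card d n)%N.
Proof. by rewrite -size_ball_seq; have := one_ball_seq n; case: (ball_seq n). Qed.

Lemma left_invariant1 a g : d 1%g (a^-1 * g)%g = d a g.
Proof. by rewrite -(d_linv a) mulg1 mulVKg. Qed.

Lemma count_ball_le (B : seq T) (P : pred T) a n : uniq B ->
  (forall g, g \in B -> P g -> d a g <= n%:R) -> (count P B <= gball_card d n)%N.
Proof.
move=> uB H; rewrite -size_ball_seq -size_filter.
rewrite -(size_map (fun g => a^-1 * g)%g); apply: uniq_leq_size.
  by rewrite map_inj_uniq ?filter_uniq//; apply: mulgI.
move=> _ /mapP[g + ->]; rewrite mem_filter => /andP[Pg gB].
by rewrite mem_ball_seq left_invariant1 H.
Qed.

Lemma gball_card_le_mul k m n :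
  (forall g, d 1%g g <= k%:R -> exists2 a, d 1%g a <= m%:R & d a g <= n%:R) ->
  (gball_card d k <= gball_card d m * gball_card d n)%N.
Proof.
move=> H; rewrite -!size_ball_seq -(@size_allpairs _ _ _ *%g).
rewrite uniq_leq_size ?ball_seq_uniq// => g; rewrite mem_ball_seq => /H[a am an].
apply/allpairsP; exists (a, a^-1 * g)%g.
by rewrite /= !mem_ball_seq am left_invariant1 an mulVKg.
Qed.
End Balls.

(** * Existence of the growth rate *)

Section Growth.
Variables (R : realType) (T : groupType) (d : T -> T -> R).
Hypotheses (d_dist : is_distance d) (d_linv : left_invariant d).
Hypotheses (d_hyp : gromov_hyperbolic d) (d_qi : quasi_isometric_to_word_dist d).

Let ball_finite n : finite_set (gball d n).
Proof. exact: quasi_isometric_finite_ball. Qed.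

(** Cutting an element at height [m] writes it as a product of elements of lengths at most [m + c]
    and [n + c]. A second cut, at height [m - c], removes the excess [c] at the price of a constant
    factor. *)
Lemma gball_card_submul : exists2 K, (0 < K)%N & forall m n,
  (gball_card d (m + n) <= gball_card d m * gball_card d n * K)%N.
Proof.
have [C C0 cut] := cut_point d_dist d_hyp d_qi.
pose c := (Num.truncn C).+1.
have Cc : C <= c%:R by rewrite ltW// truncnS_gt.
have split_add m n :
    (gball_card d (m + n) <= gball_card d (m + c) * gball_card d (n + c))%N.
  apply: gball_card_le_mul => // g; rewrite !natrD => gmn.
  have [mg|gm] := leP m%:R (d 1%g g).
    have [a am ag] := cut g m%:R (ler0n _ _) mg; exists a; first lra.
    have := ag g; rewrite gromov_product_xx// => /(_ mg); lra.
  exists g; first lra.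
  by have [/(_ g g)[_ ->]] := d_dist; rewrite ?addr_ge0.
have drop_c m : (gball_card d (m + c) <= gball_card d m * gball_card d (3 * c))%N.
  apply: gball_card_le_mul => // g; rewrite natrD natrM => gm.
  have [mc|cm] := leqP m c.
    exists 1%g; first by have [/(_ 1%g 1%g)[_ ->]] := d_dist.
    have : m%:R <= c%:R :> R by rewrite ler_nat.
    lra.
  have mc0 : 0 <= m%:R - c%:R :> R by rewrite subr_ge0 ler_nat ltnW.
  have [mg|gm'] := leP (m%:R - c%:R) (d 1%g g).
    have [a am ag] := cut g _ mc0 mg; exists a; first lra.
    have := ag g; rewrite gromov_product_xx// => /(_ mg); lra.
  exists g; first lra.
  by have [/(_ g g)[_ ->]] := d_dist; rewrite ?mulr_ge0.
exists (gball_card d (3 * c) * gball_card d (3 * c))%N.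
  by rewrite muln_gt0 gball_card_gt0.
move=> m n; apply: (leq_trans (split_add m n)).
by rewrite mulnACA leq_mul.
Qed.

Lemma growth_rate_estimate : exists v K : R,
  [/\ growth_rate d = v%:E, 0 <= v,
      forall n, v * n%:R - K <= ln (gball_card d n)%:R &
      forall e, 0 < e -> exists2 A, 0 <= A &
        forall n, ln (gball_card d n)%:R <= (v + e) * n%:R + A].
Proof.
have [K K_gt0 submul] := gball_card_submul.
have card0 n : 0 < (gball_card d n)%:R :> R by rewrite ltr0n gball_card_gt0.
have K0 : 0 < K%:R :> R by rewrite ltr0n.
have lnK0 : 0 <= ln K%:R :> R by rewrite ln_ge0// ler1n.
(* Adding [ln K] makes the logarithm of the cardinality subadditive. *)
have [v [v0 lo hi]] : exists v : R, [/\ 0 <= v,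
    forall n, v * n%:R <= ln (gball_card d n)%:R + ln K%:R &
    forall e, 0 < e -> exists2 A, 0 <= A &
      forall n, ln (gball_card d n)%:R + ln K%:R <= (v + e) * n%:R + A].
  apply: fekete => [n|m n]; first by rewrite addr_ge0// ln_ge0// ler1n gball_card_gt0.
  have : ln (gball_card d (m + n))%:R <=
      ln ((gball_card d m * gball_card d n * K)%N%:R : R).
    by rewrite ler_ln ?posrE ?ler_nat// !natrM !mulr_gt0.
  rewrite !natrM !lnM ?posrE ?mulr_gt0//; lra.
exists v, (ln K%:R); split => //.
- suff cv : (fun n => (ln (gball_card d n)%:R / n%:R)%:E) @ \oo --> v%:E.
    exact: (cvg_limn_einf_sup cv).1.
  apply: cvg_EFin; first exact: nearW.
  apply: cvg_ratio => e e0; have [A A0 HA] := hi e e0.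
  exists (A + ln K%:R) => n; have := HA n; have := lo n.
  have : 0 <= e * n%:R by rewrite mulr_ge0// ltW.
  by split; lra.
- by move=> n; have := lo n; lra.
- move=> e /hi[A A0 HA]; exists A => // n; have := HA n; lra.
Qed.
End Growth.

(** * Entropy of finite empirical measures *)

Section EmpiricalMeasures.
Variables (R : realType) (T : groupType).
Implicit Types (U V W B : seq T) (F G : T -> R).

(* A sequence [W] stands for the uniform measure on its entries, counted with
   multiplicity. *)
Definition mass W (g : T) : R := (count_mem g W)%:R / (size W)%:R.

Definition average W F : R := (\sum_(x <- W) F x) / (size W)%:R.

(** Repetitions are kept, so that [mass] turns this product into convolution. *)
Definition mulseq U V : seq T := [seq (x * y)%g | x <- U, y <- V].

Definition powseq B n : seq T := iter n (mulseq B) [:: 1%g].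

Definition entropy_seq W : R := average W (fun x => - ln (mass W x)).

(** The squared l^2 norm of the multiplicity function, that is, the number of ordered pairs of
    positions with equal entries. *)
Definition collisions W : R := \sum_(x <- undup W) (count_mem x W)%:R ^+ 2.

Lemma powseqS B n : powseq B n.+1 = mulseq B (powseq B n). Proof. by []. Qed.

Lemma size_mulseq U V : size (mulseq U V) = (size U * size V)%N.
Proof. exact: size_allpairs. Qed.

Lemma size_powseq B n : size (powseq B n) = (size B ^ n)%N.
Proof. by elim: n => // n IH; rewrite powseqS size_mulseq IH expnS. Qed.

Lemma mulseqA U V W : mulseq U (mulseq V W) = mulseq (mulseq U V) W.
Proof.
have mulS x U1 V1 : mulseq (x :: U1) V1 = map ( *%g x) V1 ++ mulseq U1 V1 by [].
elim: U => [//|x U IH]; rewrite !mulS IH /mulseq allpairs_cat; congr cat.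
by rewrite map_allpairs allpairs_mapl; apply: eq_allpairs => y z; rewrite mulgA.
Qed.

Lemma powseqD B m n : powseq B (m + n) = mulseq (powseq B m) (powseq B n).
Proof.
elim: m => [|m IH]; last by rewrite addSn !powseqS IH mulseqA.
by rewrite add0n /mulseq /= cats0 -[LHS]map_id; apply: eq_map => x; rewrite mul1g.
Qed.

Lemma average_mulseq U V F :
  average (mulseq U V) F = average U (fun x => average V (fun y => F (x * y)%g)).
Proof.
rewrite /average size_mulseq big_allpairs_dep natrM invfM mulrA mulrAC.
by rewrite -mulr_suml.
Qed.

Lemma le_average W F G : (forall x, x \in W -> F x <= G x) ->
  average W F <= average W G.
Proof.
move=> FG; rewrite ler_wpM2r ?invr_ge0//.
by rewrite big_seq [leRHS]big_seq; apply: ler_sum.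
Qed.

Lemma eq_average W F G : (forall x, x \in W -> F x = G x) ->
  average W F = average W G.
Proof. by move=> FG; apply/le_anti; rewrite !le_average// => x /FG ->. Qed.

Lemma averageD W F G : average W (fun x => F x + G x) = average W F + average W G.
Proof. by rewrite /average big_split mulrDl. Qed.

Lemma averageZ W a F : average W (fun x => a * F x) = a * average W F.
Proof. by rewrite /average -mulr_sumr mulrA. Qed.

Lemma average_cst W a : (0 < size W)%N -> average W (fun=> a) = a.
Proof.
move=> W0; rewrite /average big_const_seq count_predT iter_addr_0.
by rewrite -[X in X / _]mulr_natr mulfK// pnatr_eq0 -lt0n.
Qed.

Lemma average_ge0 W F : (forall x, x \in W -> 0 <= F x) -> 0 <= average W F.
Proof. by move=> F0; rewrite divr_ge0// big_seq sumr_ge0. Qed.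

Lemma mass_average W g : mass W g = average W (fun x => (x == g)%:R).
Proof.
rewrite /mass /average -sum1_count natr_sum big_mkcond; congr (_ / _).
by apply: eq_bigr => x _ /=; case: (x == g).
Qed.

Lemma mass_ge0 W g : 0 <= mass W g. Proof. by rewrite divr_ge0. Qed.

Lemma mass_gt0 W g : g \in W -> 0 < mass W g.
Proof.
move=> gW; have := gW; rewrite -has_pred1 has_count => cg.
by rewrite divr_gt0// ltr0n// (leq_trans cg)// count_size.
Qed.

Lemma mass_le1 W g : mass W g <= 1.
Proof.
rewrite /mass; have [->|W0] := eqVneq (size W) 0%N; first by rewrite invr0 mulr0.
by rewrite ler_pdivrMr ?ltr0n ?lt0n// mul1r ler_nat count_size.
Qed.

Lemma Nln_mass_ge0 W g : 0 <= - ln (mass W g).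
Proof. by rewrite oppr_ge0 ln_le0// mass_le1. Qed.

Lemma sum_undup W F :
  \sum_(x <- undup W) (count_mem x W)%:R * F x = \sum_(x <- W) F x.
Proof.
rewrite -[RHS]big_undup_iterop_count; apply: eq_bigr => x _.
by rewrite mulr_natl Monoid.iteropE /= -iter_addr_0.
Qed.

Lemma average_undup W F :
  average W F = \sum_(x <- undup W) mass W x * F x.
Proof.
rewrite /average -sum_undup mulr_suml; apply: eq_bigr => x _.
by rewrite /mass mulrAC.
Qed.

(** Reduces the unordered sums defining convolution, entropy and mean length to finite averages. *)
Lemma esum_mass W F : (forall x, 0 <= F x) ->
  \esum_(g in [set: T]) (mass W g * F g)%:E = (average W F)%:E.
Proof.
move=> F0; transitivity (\esum_(g in [set` undup W]) (mass W g * F g)%:E).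
  rewrite [RHS]esum_mkcond; apply: eq_esum => g _.
  case: ifPn => //; rewrite notin_setE /= mem_undup => /negP gW.
  by rewrite /mass (count_memPn gW) mul0r mul0r.
rewrite esum_fset; last 2 first.
- exact: finite_seq.
- by move=> g _; rewrite lee_fin mulr_ge0// mass_ge0.
rewrite -fsbig_seq ?undup_uniq// sumEFin; congr (_%:E).
by rewrite average_undup.
Qed.

Lemma convolution_mass U V : convolution (mass U) (mass V) = mass (mulseq U V).
Proof.
apply/funext => g; rewrite /convolution esum_mass => [/=|h]; last exact: mass_ge0.
rewrite mass_average average_mulseq; apply: eq_average => h _.
rewrite mass_average; apply: eq_average => x _; congr ((nat_of_bool _)%:R : R).
by apply/eqP/eqP => [->|<-]; rewrite ?mulVKg ?mulKg.
Qed.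

Lemma convolution_power_mass B n :
  convolution_power (mass B) n = mass (powseq B n).
Proof.
elim: n => [|n IH]; last by rewrite powseqS -convolution_mass -IH.
apply/funext => g /=; rewrite /mass /= addn0 divr1 eq_sym.
by case: eqP.
Qed.

Lemma entropy_mass W : entropy (mass W) = (entropy_seq W)%:E.
Proof. by apply: esum_mass => x; apply: Nln_mass_ge0. Qed.

Lemma mean_length_mass (d : T -> T -> R) W : (forall x y, 0 <= d x y) ->
  mean_length d (mass W) = (average W (d 1%g))%:E.
Proof. by move=> d0; apply: esum_mass. Qed.

(** The pair [(x, y)] is one of the factorisations of the product. *)
Lemma mass_mulseq_ge U V x y : mass U x * mass V y <= mass (mulseq U V) (x * y)%g.
Proof.
rewrite [leRHS]mass_average average_mulseq mulrC [mass U x]mass_average -averageZ.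
apply: le_average => x' _; rewrite mulrC [mass V y]mass_average -averageZ.
apply: le_average => y' _.
by have [->|_] := eqVneq x' x; rewrite ?mul0r// mul1r; case: eqVneq => [->|_] //; rewrite eqxx.
Qed.

Lemma entropy_seq_ge0 W : 0 <= entropy_seq W.
Proof. by apply: average_ge0 => x _; apply: Nln_mass_ge0. Qed.

Lemma entropy_mulseq U V : (0 < size U)%N -> (0 < size V)%N ->
  entropy_seq (mulseq U V) <= entropy_seq U + entropy_seq V.
Proof.
move=> U0 V0; rewrite {1}/entropy_seq average_mulseq.
rewrite -[X in _ <= _ + X](average_cst _ U0) -averageD; apply: le_average => x xU.
rewrite -[X in _ <= X + _](average_cst _ V0) -averageD; apply: le_average => y yV.
have [px py] := (mass_gt0 xU, mass_gt0 yV).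
have pxy : 0 < mass U x * mass V y by rewrite mulr_gt0.
have le_xy := mass_mulseq_ge U V x y.
by rewrite -opprD lerN2 -lnM ?posrE// ler_ln ?posrE// (lt_le_trans pxy).
Qed.

Lemma average_ln_le W F : (0 < size W)%N -> (forall x, x \in W -> 0 < F x) ->
  average W (fun x => ln (F x)) <= average W F - 1.
Proof.
move=> W0 F0; rewrite -[X in _ - X](average_cst _ W0) -mulN1r -averageZ -averageD.
by apply: le_average => x xW; rewrite mulN1r ln_le_subr1// F0.
Qed.

(** The ratio of the normalised weight [F / Z] to [mass W] has average 1, so its logarithm has
    nonpositive average. *)
Lemma gibbs W F : (0 < size W)%N -> (forall x, 0 < F x) ->
  entropy_seq W <= average W (fun x => - ln (F x)) + ln (\sum_(x <- undup W) F x).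
Proof.
move=> W0 F0; set Z := \sum_(x <- undup W) F x.
have Z0 : 0 < Z.
  rewrite /Z; case: W W0 @Z => [//|x W] _ Z.
  rewrite (bigD1_seq x) ?undup_uniq ?mem_undup ?mem_head//=.
  by rewrite ltr_pwDl// sumr_ge0// => y _; apply: ltW.
have H : average W (fun x => ln (F x / (Z * mass W x))) <= 0.
  rewrite (le_trans (average_ln_le W0 _))//.
    by move=> x xW; rewrite divr_gt0// mulr_gt0// mass_gt0.
  rewrite average_undup subr_le0.
  rewrite (_ : \sum_(x <- _) _ = \sum_(x <- undup W) F x / Z).
    by rewrite -mulr_suml -/Z divff ?gt_eqF.
  rewrite big_seq [RHS]big_seq; apply: eq_bigr => x; rewrite mem_undup => /mass_gt0.
  by move=> m0; field; rewrite !gt_eqF.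
suff -> : entropy_seq W =
    average W (fun x => ln (F x / (Z * mass W x)) + - ln (F x) + ln Z).
  by rewrite !averageD (average_cst _ W0); lra.
apply: eq_average => x xW; have m0 := mass_gt0 xW.
have Zm0 : 0 < Z * mass W x by rewrite mulr_gt0.
by rewrite ln_div ?posrE// lnM ?posrE//; lra.
Qed.

Lemma collisions_gt0 W : (0 < size W)%N -> 0 < collisions W.
Proof.
case: W => [//|x W] _; rewrite /collisions (bigD1_seq x) ?undup_uniq ?mem_undup ?mem_head//=.
apply: ltr_pwDl; first by rewrite exprn_gt0// ltr0n eqxx.
by apply: sumr_ge0 => y _; apply: sqr_ge0.
Qed.

(** Jensen's inequality for [ln]: the average of [mass W] is [c], the number of collisions divided
    by the square of the size. *)
Lemma entropy_ge_collisions W : (0 < size W)%N ->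
  2 * ln (size W)%:R - ln (collisions W) <= entropy_seq W.
Proof.
move=> W0; have s0 : 0 < (size W)%:R :> R by rewrite ltr0n.
have c0 := collisions_gt0 W0.
pose c := collisions W / (size W)%:R ^+ 2.
have cp : 0 < c by rewrite divr_gt0 ?exprn_gt0.
have cE : average W (mass W) = c.
  rewrite average_undup /c /collisions mulr_suml; apply: eq_bigr => x _.
  by rewrite /mass; field; rewrite gt_eqF.
have -> : 2 * ln (size W)%:R - ln (collisions W) = - ln c.
  by rewrite /c ln_div ?posrE ?exprn_gt0// lnXn//; lra.
move: c cp cE => c cp cE.
have H : average W (fun x => ln (c^-1 * mass W x)) <= 0.
  rewrite (le_trans (average_ln_le W0 _))//.
    by move=> x xW; rewrite mulr_gt0 ?invr_gt0 ?mass_gt0.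
  by rewrite averageZ cE mulVf ?gt_eqF// subrr.
suff -> : - ln c = average W (fun x => ln (c^-1 * mass W x) + - ln (mass W x)).
  by rewrite averageD -/(entropy_seq W); lra.
rewrite -[LHS](average_cst _ W0); apply: eq_average => x xW.
by rewrite lnM ?posrE ?invr_gt0 ?mass_gt0// lnV ?posrE//; lra.
Qed.
End EmpiricalMeasures.

(** * Rapid decay *)

Section SchurTest.
Variables (R : realType) (T : groupType).

Lemma weighted_cauchy_schwarz (I : Type) (s : seq I) (a n : I -> R) :
  (forall i, 0 < n i) ->
  (\sum_(i <- s) a i) ^+ 2 <=
    (\sum_(i <- s) (n i)^-1) * (\sum_(i <- s) n i * a i ^+ 2).
Proof.
(* Once the double sum is symmetrised, the difference of the two sides is termwise a square over a
   positive number. *)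
move=> n0; pose P i j := (n i)^-1 * (n j * a j ^+ 2).
have -> : (\sum_(i <- s) (n i)^-1) * (\sum_(i <- s) n i * a i ^+ 2) =
    \sum_(i <- s) \sum_(j <- s) (P i j + P j i) / 2.
  have PE : (\sum_(i <- s) (n i)^-1) * (\sum_(i <- s) n i * a i ^+ 2) =
    \sum_(i <- s) \sum_(j <- s) P i j by rewrite big_distrlr.
  under [RHS]eq_bigr do rewrite -mulr_suml big_split /=.
  by rewrite -mulr_suml big_split /= [X in _ + X]exchange_big /= -PE; lra.
rewrite expr2 big_distrlr /=; apply: ler_sum => i _; apply: ler_sum => j _.
have ni := n0 i; have nj := n0 j.
rewrite -subr_ge0 (_ : _ - _ = (n j * a j - n i * a i) ^+ 2 / (2 * n i * n j)).
  by rewrite divr_ge0 ?sqr_ge0// !mulr_ge0// ltW.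
by rewrite /P; field; rewrite !gt_eqF.
Qed.

Lemma sum_translate_le (Z W : seq T) (F : T -> R) g : uniq Z ->
  (forall x, 0 <= F x) -> (forall x, x \notin W -> F x = 0) ->
  \sum_(z <- Z) F (g^-1 * z)%g <= \sum_(h <- undup W) F h.
Proof.
move=> uZ F0 FW.
rewrite -(big_map (fun z => g^-1 * z)%g xpredT F); set Z' := map _ Z.
have uZ' : uniq Z' by rewrite map_inj_uniq//; apply: mulgI.
rewrite (bigID (fun h => h \in W)) /= [X in _ + X]big1 ?addr0//.
rewrite [leRHS](bigID (fun h => h \in Z')) /= ler_wpDr ?sumr_ge0//.
rewrite -[leLHS]big_filter -[leRHS]big_filter le_eqVlt; apply/orP; left.
apply/eqP/perm_big/uniq_perm; rewrite ?filter_uniq ?undup_uniq//.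
by move=> x; rewrite !mem_filter mem_undup andbC.
Qed.

Lemma count_mulseq (B W : seq T) z :
  (count_mem z (mulseq B W))%:R = \sum_(g <- B) (count_mem (g^-1 * z)%g W)%:R :> R.
Proof.
rewrite -sum1_count natr_sum big_mkcond big_allpairs_dep /=.
apply: eq_bigr => g _; rewrite -sum1_count natr_sum [RHS]big_mkcond.
apply: eq_bigr => h _; congr (if _ then _ else _).
by apply/eqP/eqP => [<-|->]; rewrite ?mulKg ?mulVKg.
Qed.

(** Schur test: apply Cauchy-Schwarz with weights [n] to the sum over [g] of [phi (g^-1 * z)], then
    sum over [z = g * h] with [h] fixed. *)
Lemma collisions_mulseq_le (B W : seq T) (n : T -> T -> R) A D :
  (forall g z, 0 < n g z) ->
  (forall z, \sum_(g <- B) (n g z)^-1 <= A) ->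
  (forall h, \sum_(g <- B) n g (g * h)%g <= D) ->
  collisions R (mulseq B W) <= A * D * collisions R W.
Proof.
move=> n0 HA HD; set Z := undup (mulseq B W).
pose phi h : R := (count_mem h W)%:R.
have A0 : 0 <= A.
  by apply: le_trans (HA 1%g); rewrite sumr_ge0// => g _; rewrite invr_ge0 ltW.
apply: (@le_trans _ _ (\sum_(z <- Z) A *
    \sum_(g <- B) n g z * phi (g^-1 * z)%g ^+ 2)).
  apply: ler_sum => z _; rewrite count_mulseq.
  apply: (le_trans (weighted_cauchy_schwarz _ _ (n0^~ z))).
  rewrite ler_wpM2r// sumr_ge0// => g _.
  by rewrite mulr_ge0 ?sqr_ge0// ltW.
rewrite -mulr_sumr -mulrA ler_wpM2l// exchange_big /=.
apply: (@le_trans _ _ (\sum_(g <- B) \sum_(h <- undup W) n g (g * h)%g * phi h ^+ 2)).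
  apply: ler_sum => g _.
  under eq_bigr => z _ do rewrite -{1}(mulVKg g z).
  apply: (@sum_translate_le _ _ (fun h => n g (g * h)%g * phi h ^+ 2)).
  - exact: undup_uniq.
  - by move=> h; rewrite mulr_ge0 ?sqr_ge0// ltW.
  - by move=> h hW; rewrite /phi (count_memPn hW) expr0n mulr0.
rewrite exchange_big /collisions /= mulr_sumr; apply: ler_sum => h _.
by rewrite -mulr_suml ler_wpM2r ?sqr_ge0.
Qed.

Lemma collisions_powseq_le (B : seq T) Q n : 0 <= Q ->
  (forall W, collisions R (mulseq B W) <= Q * collisions R W) ->
  collisions R (powseq B n) <= Q ^+ n.
Proof.
move=> Q0 H; elim: n => [|n IH].
  by rewrite expr0 /collisions big_seq1 /= eqxx addn0 expr1n.
by rewrite powseqS exprS (le_trans (H _))// ler_wpM2l.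
Qed.
End SchurTest.

(** * Counting factorisations by the legs of their tripods *)

Section RapidDecay.
Variables (R : realType) (T : groupType) (d : T -> T -> R).
Hypotheses (d_dist : is_distance d) (d_linv : left_invariant d).
Hypotheses (d_hyp : gromov_hyperbolic d) (d_qi : quasi_isometric_to_word_dist d).

Let ball_finite n : finite_set (gball d n).
Proof. exact: quasi_isometric_finite_ball. Qed.

Local Notation gp := (gromov_product d).

Lemma gromov_product_ge0 x y z : 0 <= gp x y z.
Proof.
have [_ d_sym d_tri] := d_dist.
by have := d_tri y x z; rewrite /gromov_product (d_sym y x); lra.
Qed.

Lemma sum_le_count (B : seq T) (P : pred T) (F : T -> R) x :
  (forall g, g \in B -> P g -> F g <= x) ->
  \sum_(g <- B | P g) F g <= (count P B)%:R * x.
Proof.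
move=> H; rewrite -sum1_count natr_sum mulr_suml big_seq_cond [leRHS]big_seq_cond.
by apply: ler_sum => g /andP[gB Pg]; rewrite mul1r H.
Qed.

(* A factorisation [z = g h] with [g] in the ball of radius [i] is sorted by
   the lengths [t] and [s] of the two legs of the tripod [1, g, z] that end at
   [1] and at [g]. Given [z] (resp. [h]), the point [g] (resp. [g^-1]) is
   within about [s] (resp. [t]) of a point determined by [t] (resp. [s]). *)
Let leg1 g z := Num.truncn (gp 1%g g z).
Let legg g z := Num.truncn (gp g 1%g z).

Lemma legP g z :
  [/\ (leg1 g z)%:R <= gp 1%g g z, (legg g z)%:R <= gp g 1%g z,
      gp 1%g g z < (leg1 g z)%:R + 1 & gp g 1%g z < (legg g z)%:R + 1].
Proof. by rewrite !truncn_le !gromov_product_ge0 !natr1 !truncnS_gt. Qed.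

(** Schur test with weight [|B_(s+c)|]. For given legs [t] and [s], at most [|B_(s+c)|] elements [g]
    occur with [z] fixed and at most [|B_(t+c)|] with [h] fixed. Each of the two sums runs over at
    most [(i+1)^2] pairs of legs, hence the fourth power. *)
Lemma rapid_decay_ball : exists c, forall i (M : R),
  (forall t s, (t + s <= i)%N ->
     (gball_card d (t + c) * gball_card d (s + c))%:R <= M) ->
  forall W, collisions R (mulseq (ball_seq d i) W) <=
    (i.+1 ^ 4)%:R * M * collisions R W.
Proof.
have [C C0 cut] := cut_point d_dist d_hyp d_qi.
have [_ d_sym _] := d_dist.
(* The 2 pays for rounding down both legs. *)
pose c := ((Num.truncn C).+1 + 2)%N.
have Cc : C + 2 <= c%:R by rewrite natrD lerD2r ltW// truncnS_gt.
have {cut} cut_card (B : seq T) (P : pred T) (f : T -> T) z t s :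
    uniq B -> injective f ->
    (forall g, g \in B -> P g -> t%:R <= gp 1%g (f g) z) ->
    (forall g, g \in B -> P g -> d 1%g (f g) <= t%:R + s%:R + 2) ->
    (count P B <= gball_card d (s + c))%N.
  move=> uB finj Pt Ps; case: (posnP (count P B)) => [->//|].
  rewrite -has_count => /hasP[g0 g0B Pg0].
  have tz : t%:R <= d 1%g z.
    by rewrite (le_trans (Pt _ g0B Pg0))// gromov_product_ler.
  have [a _ Ha] := cut z t%:R (ler0n _ _) tz.
  rewrite -size_filter -(size_map f) -(count_predT (map _ _)).
  apply: (@count_ball_le _ _ _ d_linv ball_finite _ _ a) => [|_ /mapP[g + ->] _].
    by rewrite map_inj_uniq ?filter_uniq.
  rewrite mem_filter => /andP[Pg gB]; have := Ha _ (Pt _ gB Pg).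
  have := Ps _ gB Pg; rewrite natrD; lra.
exists c => i M HM W; set B := ball_seq d i.
have uB : uniq B by apply: ball_seq_uniq.
have leg_sum g z : g \in B -> (leg1 g z + legg g z <= i)%N.
  rewrite mem_ball_seq// => gi; rewrite -(ler_nat R) natrD.
  have [h1 h2 _ _] := legP g z; have := gromov_productDl d_dist 1%g g z; lra.
(* On the ball, [inord] does not alter the legs, whose sum is at most [i]. *)
pose kappa z g : 'I_i.+1 * 'I_i.+1 := (inord (leg1 g z), inord (legg g z)).
have kappaP z g k : g \in B -> kappa z g == k ->
    leg1 g z = k.1 /\ legg g z = k.2.
  move=> gB /eqP <-; have := leg_sum g z gB => ?; split; rewrite /= inordK//; lia.
have dist_leg z g k : g \in B -> kappa z g == k ->
    d 1%g g <= (k.1 : nat)%:R + (k.2 : nat)%:R + 2.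
  move=> gB /(kappaP _ _ _ gB)[<- <-]; have [_ _ h1 h2] := legP g z.
  have := gromov_productDl d_dist 1%g g z; lra.
have count_z z k : (count (fun g => kappa z g == k) B <= gball_card d (k.2 + c))%N.
  apply: (@cut_card _ _ id z k.1) => // [g gB /(kappaP _ _ _ gB)[<- _]|g].
    by have [] := legP g z.
  exact: dist_leg.
(* Translating the tripod by [g^-1] moves its vertices to [g^-1], [1] and [h]: the two legs exchange
   roles. *)
have count_h h k : (count (fun g => kappa (g * h)%g g == k) B <= gball_card d (k.1 + c))%N.
  apply: (@cut_card _ _ (fun g => g^-1%g) h k.2) => // [|g gB kg|g gB kg].
  - exact: invg_inj.
  - have [_ <-] := kappaP _ _ _ gB kg.
    have -> : gp 1%g g^-1%g h = gp g 1%g (g * h)%g.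
      rewrite /gromov_product -(d_linv g 1%g g^-1%g) -(d_linv g 1%g h) -(d_linv g g^-1%g h).
      by rewrite mulg1 mulgV.
    by have [] := legP g (g * h)%g.
  have -> : d 1%g g^-1%g = d 1%g g by rewrite -(d_linv g) mulg1 mulgV d_sym.
  by have := dist_leg _ _ _ gB kg; lra.
have card_kappa : #|{: 'I_i.+1 * 'I_i.+1}| = (i.+1 ^ 2)%N.
  by rewrite card_prod card_ord expnS expn1.
have card0 m : 0 < (gball_card d m)%:R :> R by rewrite ltr0n gball_card_gt0.
have M0 : 0 <= M by rewrite (le_trans _ (HM 0%N 0%N isT)).
rewrite (expnD i.+1 2 2) natrM -(mulrA (i.+1 ^ 2)%:R).
apply: (@collisions_mulseq_le _ _ _ _ (fun g z => (gball_card d (legg g z + c))%:R)) => //.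
- move=> z; rewrite (partition_big (kappa z) xpredT)//= -card_kappa.
  rewrite -sum1_card natr_sum; apply: ler_sum => k _.
  apply: (@le_trans _ _ ((count (fun g => kappa z g == k) B)%:R *
      (gball_card d (k.2 + c))%:R^-1)).
    by apply: sum_le_count => g gB /(kappaP _ _ _ gB)[_ ->].
  by rewrite ler_pdivrMr// mul1r ler_nat.
move=> h; rewrite (partition_big (fun g => kappa (g * h)%g g) xpredT)//=.
rewrite -card_kappa -sum1_card natr_sum mulr_suml; apply: ler_sum => k _.
rewrite mul1r; have [ki|ki] := leqP (k.1 + k.2) i; last first.
  rewrite big_seq_cond big_pred0// => g; apply/negbTE/negP => /andP[gB kg].
  have [e1 e2] := kappaP _ _ _ gB kg; have := leg_sum g (g * h)%g gB.
  by rewrite e1 e2 leqNgt ki.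
apply: (@le_trans _ _ ((count (fun g => kappa (g * h)%g g == k) B)%:R *
    (gball_card d (k.2 + c))%:R)).
  by apply: sum_le_count => g gB /(kappaP _ _ _ gB)[_ ->].
by apply: le_trans (HM _ _ ki); rewrite natrM ler_wpM2r// ler_nat.
Qed.
End RapidDecay.

(** * The walk driven by the uniform measure on a ball *)

Section RandomWalkOnBall.
Variables (R : realType) (T : groupType) (d : T -> T -> R).
Hypotheses (d_dist : is_distance d) (d_linv : left_invariant d).
Hypothesis ball_finite : forall n, finite_set (gball d n).

Lemma unif_ball_mass i : unif_ball d i = mass R (ball_seq d i).
Proof.
apply/funext => g; rewrite /unif_ball /mass size_ball_seq count_uniq_mem ?ball_seq_uniq//.
have -> : (g \in gball d i) = (d 1%g g <= i%:R) by apply/idP/idP; rewrite inE.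
by rewrite mem_ball_seq//; case: ifP; rewrite ?mul1r ?mul0r.
Qed.

Lemma average_dist_mulseq U V : (0 < size U)%N -> (0 < size V)%N ->
  average (mulseq U V) (d 1%g) <= average U (d 1%g) + average V (d 1%g).
Proof.
move=> U0 V0; rewrite average_mulseq -[X in _ <= _ + X](average_cst _ U0) -averageD.
apply: le_average => x _; rewrite -[X in _ <= X + _](average_cst _ V0) -averageD.
apply: le_average => y _; have [_ _ d_tri] := d_dist.
by rewrite (le_trans (d_tri _ x _))// lerD2l -(d_linv x 1%g) mulg1.
Qed.

Lemma powseq_ball_dist i n x : x \in powseq (ball_seq d i) n ->
  d 1%g x <= (i * n)%:R.
Proof.
have [d0 _ d_tri] := d_dist; elim: n x => [|n IH] x.
  by rewrite mem_seq1 => /eqP ->; rewrite (d0 1%g 1%g).2.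
rewrite powseqS => /allpairsP[[g h] /= [+ /IH hn ->]]; rewrite mem_ball_seq// => gi.
rewrite (le_trans (d_tri _ g _))// mulnS natrD lerD//.
by rewrite -{1}(mulg1 g) d_linv.
Qed.

(** Each of the [N + 1] shells [k <= |x| <= k + 1] contributes at most [|B_(k+1)| exp(- s k)], hence
    at most [exp(s + A)]. *)
Lemma sum_expR_ball_le (W : seq T) N (s A : R) : 0 <= s -> 0 <= A -> uniq W ->
  (forall x, x \in W -> d 1%g x <= N%:R) ->
  (forall n, ln (gball_card d n)%:R <= s * n%:R + A) ->
  \sum_(x <- W) expR (- (s * d 1%g x)) <= N.+1%:R * expR (s + A).
Proof.
move=> s0 A0 uW WN growth.
pose p x : 'I_N.+1 := inord (Num.truncn (d 1%g x)).
rewrite (partition_big p xpredT)//= -[X in X%:R * _]card_ord -sum1_card natr_sum mulr_suml.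
apply: ler_sum => k _; rewrite mul1r.
have pP x : x \in W -> p x == k -> k%:R <= d 1%g x /\ d 1%g x <= k.+1%:R.
  move=> xW /eqP <-; have dx0 := dist_ge0 d_dist 1%g x.
  have xN : (Num.truncn (d 1%g x) < N.+1)%N.
    by rewrite ltnS -(ler_nat R) (le_trans _ (WN _ xW))// truncn_le.
  by rewrite /p inordK// truncn_le dx0 ltW// truncnS_gt.
apply: (@le_trans _ _ ((count (fun x => p x == k) W)%:R * expR (- (s * k%:R)))).
  apply: sum_le_count => x xW /(pP _ xW)[kx _].
  by rewrite ler_expR lerN2 ler_wpM2l.
have cle : (count (fun x => p x == k) W <= gball_card d k.+1)%N.
  by apply: (@count_ball_le _ _ _ d_linv ball_finite _ _ 1%g) => // x xW /(pP _ xW)[].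
apply: (@le_trans _ _ ((gball_card d k.+1)%:R * expR (- (s * k%:R)))).
  by rewrite ler_wpM2r ?expR_ge0// ler_nat.
have c0 : 0 < (gball_card d k.+1)%:R :> R by rewrite ltr0n gball_card_gt0.
rewrite -[X in X * _](lnK c0) -expRD ler_expR.
have := growth k.+1; rewrite -natr1; lra.
Qed.

(** Fekete's lemma provides [h] and [l]; the inequalities follow by comparing slopes in bounds
    affine in the time [n]. *)
Lemma ball_walk_estimate i (v : R) : 0 <= v ->
  (forall e, 0 < e -> exists2 A, 0 <= A &
     forall n, ln (gball_card d n)%:R <= (v + e) * n%:R + A) ->
  exists h l : R, [/\ asymptotic_entropy (unif_ball d i) = h%:E,
    drift d (unif_ball d i) = l%:E, [/\ 0 <= h, 0 <= l & l <= i%:R],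
    h <= v * l &
    forall Q, 0 < Q -> (forall W,
      collisions R (mulseq (ball_seq d i) W) <= Q * collisions R W) ->
      2 * ln (gball_card d i)%:R - ln Q <= h].
Proof.
move=> v0 growth; set B := ball_seq d i.
pose H n := entropy_seq R (powseq B n); pose L n := average (powseq B n) (d 1%g).
have size_gt0 n : (0 < size (powseq B n))%N.
  by rewrite size_powseq expn_gt0 size_ball_seq gball_card_gt0.
have d0 := dist_ge0 d_dist.
have H0 n : 0 <= H n by apply: entropy_seq_ge0.
have L0 n : 0 <= L n by apply: average_ge0.
have HD m n : H (m + n)%N <= H m + H n.
  by rewrite /H powseqD entropy_mulseq.
have LD m n : L (m + n)%N <= L m + L n.
  by rewrite /L powseqD average_dist_mulseq.
have lim_of (u : nat -> R) w : (forall n, w * n%:R <= u n) ->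
    (forall e, 0 < e -> exists2 A, 0 <= A & forall n, u n <= (w + e) * n%:R + A) ->
    limn (fun n => ((u n)%:E * (n%:R^-1)%:E)%E) = w%:E.
  move=> lo hi; apply: cvg_lim => //; apply: cvg_EFin; first exact: nearW.
  apply: cvg_ratio => e e0; have [A A0 HA] := hi e e0; exists A => n; split => //.
  have := lo n; have : 0 <= e * n%:R by rewrite mulr_ge0// ltW.
  lra.
have [h [h0 hlo hhi]] := fekete H0 HD; have [l [l0 llo lhi]] := fekete L0 LD.
exists h, l; split.
- rewrite -(lim_of _ _ hlo hhi) /asymptotic_entropy.
  under eq_fun => n do rewrite unif_ball_mass convolution_power_mass entropy_mass.
  by [].
- rewrite -(lim_of _ _ llo lhi) /drift.
  under eq_fun => n do rewrite unif_ball_mass convolution_power_mass mean_length_mass//.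
  by [].
- split => //; apply: (@le_slope _ _ _ 0) => n; rewrite addr0 (le_trans (llo n))//.
  rewrite -natrM -[leRHS](average_cst _ (size_gt0 n)); apply: le_average => x.
  exact: powseq_ball_dist.
- have key e : 0 < e -> h <= (v + e) * (l + e) + e.
    move=> e0; have [A A0 HA] := growth e e0; have [K K0 HK] := lhi e e0.
    have s0 : 0 <= v + e by lra.
    have i1 : 0 < i.+1%:R :> R by rewrite ltr0n.
    (* This slope makes [ln (i * n + 1)], from the number of shells, cost at most [e * n] plus a
       constant. *)
    have [K1 K10 lnlin] := @ln_le_linear R (e / i.+1%:R) (divr_gt0 e0 i1).
    apply: (@le_slope _ _ _ ((v + e) * K + (e + K1) + (v + e + A))) => n.
    apply: (le_trans (hlo n)).
    have gib := gibbs (size_gt0 n) (fun x => expR_gt0 (- ((v + e) * d 1%g x))).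
    apply: (le_trans gib).
    under eq_average => x _ do rewrite expRK opprK.
    rewrite averageZ -/(L n).
    have Z_le := @sum_expR_ball_le (undup (powseq B n)) (i * n) _ _ s0 A0
      (undup_uniq _) _ HA.
    have {}Z_le : ln (\sum_(x <- undup (powseq B n)) expR (- ((v + e) * d 1%g x)))
        <= ln ((i * n).+1%:R * expR (v + e + A)).
      rewrite ler_ln ?posrE ?mulr_gt0 ?ltr0n ?expR_gt0//.
        by apply: Z_le => x; rewrite mem_undup; apply: powseq_ball_dist.
      have := size_gt0 n; case: (powseq B n) => [//|x s] _.
      rewrite (bigD1_seq x) ?undup_uniq ?mem_undup ?mem_head//=.
      by rewrite ltr_pwDl ?expR_gt0// sumr_ge0// => y _; apply: expR_ge0.
    rewrite lnM ?posrE ?ltr0n ?expR_gt0// expRK in Z_le.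
    have ln_le : ln (i * n).+1%:R <= e * n%:R + (e + K1).
      have := lnlin (i * n).+1%:R; rewrite ltr0n => /(_ isT) /le_trans; apply.
      rewrite addrA lerD2r mulrAC ler_pdivrMr//.
      have -> : (e * n%:R + e) * i.+1%:R = e * (n.+1 * i.+1)%:R.
        by rewrite natrM -[n.+1%:R]natr1; ring.
      by rewrite ler_pM2l// ler_nat mulSn mulnS (mulnC n i) addSn ltnS addnA leq_addl.
    have := ler_wpM2l s0 (HK n); lra.
  (* For [e <= 1] the bound [key] is at most [v * l + e * D]; the choice [e = eta / (D + eta)] makes
     this smaller than [h]. *)
  rewrite leNgt; apply/negP => vlh; pose eta := h - v * l; pose D := v + l + 2.
  have eta0 : 0 < eta by rewrite subr_gt0.
  have D0 : 0 < D by rewrite /D; lra.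
  have De0 : 0 < D + eta by lra.
  have e0 : 0 < eta / (D + eta) by rewrite divr_gt0.
  have e1 : eta / (D + eta) <= 1 by rewrite ler_pdivrMr//; lra.
  have eD : eta / (D + eta) * D < eta.
    by rewrite mulrAC ltr_pdivrMr// ltr_pM2l//; lra.
  have := key _ e0; move: (eta / _) e0 e1 eD => e e0 e1; rewrite /eta /D => eD.
  have : e * e <= e * 1 by rewrite ler_wpM2l// ltW.
  lra.
move=> Q Q0 HQ; have cn n : (2 * ln (gball_card d i)%:R - ln Q) * n%:R <= H n.
  have := entropy_ge_collisions R (size_gt0 n).
  rewrite size_powseq size_ball_seq natrX lnXn ?ltr0n ?gball_card_gt0//.
  have : ln (collisions R (powseq B n)) <= ln (Q ^+ n).
    rewrite ler_ln ?posrE ?collisions_gt0 ?exprn_gt0//.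
    exact: collisions_powseq_le (ltW Q0) HQ.
  rewrite lnXn// -[ln Q *+ n]mulr_natr -[X in 2 * X]mulr_natr /H; lra.
rewrite leNgt; apply/negP => hQ.
set c := _ - _ in cn hQ.
have [A A0 HA] := hhi ((c - h) / 2) ltac:(lra).
have : c <= h + (c - h) / 2.
  by apply: (@le_slope _ _ _ A) => n; apply: le_trans (cn n) (HA n).
lra.
Qed.
End RandomWalkOnBall.

(* When T is virtually cyclic the drift, the entropy and v all vanish; the
   quotient is then 0 / 0 = 0. *)
Theorem theorem1p4 (R : realType) (T : groupType) (d : T -> T -> R)
    (T_infinite : infinite_set [set: T])
    (T_hyperbolic : hyperbolic_group R T)
    (d_distance : is_distance d)
    (d_left_invariant : left_invariant d)
    (d_hyperbolic : gromov_hyperbolic d)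
    (d_quasi_isometric : quasi_isometric_to_word_dist d) :
  (fun i : nat =>
     (fine (asymptotic_entropy (unif_ball d i))
        / fine (drift d (unif_ball d i)))%:E)
    @ \oo --> growth_rate d.
Proof.
have finB := quasi_isometric_finite_ball d_quasi_isometric.
have [v [K [-> v0 vlo vhi]]] :=
  growth_rate_estimate d_distance d_left_invariant d_hyperbolic d_quasi_isometric.
have [c decay] :=
  rapid_decay_ball d_distance d_left_invariant d_hyperbolic d_quasi_isometric.
have walk i := ball_walk_estimate d_distance d_left_invariant finB i v0 vhi.
apply: cvg_EFin; first exact: nearW.
apply/cvgrPdist_le => e e0.
(* The lower bound on the entropy loses [5 * b = e / 2] in slope: [4 * b] for the factor [(i + 1)^4]
   and [b] for the growth bound in [M]. All constant losses go into [K2]. *)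
pose b := e / 10; have b0 : 0 < b by rewrite divr_gt0.
have [A A0 HA] := vhi b b0.
have [K1 K10 lnlin] := ln_le_linear b0.
pose K2 := 2 * K + 4 * (b + K1) + ((v + b) * (2 * c%:R) + 2 * A).
have lower i h :
    (forall Q, 0 < Q -> (forall W, collisions R (mulseq (ball_seq d i) W) <=
        Q * collisions R W) -> 2 * ln (gball_card d i)%:R - ln Q <= h) ->
    (v - e / 2) * i%:R - K2 <= h.
  move=> Hh; pose M := expR ((v + b) * (i%:R + 2 * c%:R) + 2 * A).
  have M0 : 0 < M by apply: expR_gt0.
  have i0 : 0 < (i.+1 ^ 4)%:R :> R by rewrite ltr0n expn_gt0.
  have cM t s : (t + s <= i)%N ->
      (gball_card d (t + c) * gball_card d (s + c))%:R <= M.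
    move=> tsi; have card0 n : 0 < (gball_card d n)%:R :> R.
      by rewrite ltr0n gball_card_gt0.
    rewrite natrM -[leLHS]lnK ?posrE ?mulr_gt0// ler_expR lnM ?posrE//.
    have := HA (t + c)%N; have := HA (s + c)%N; rewrite !natrD.
    have : (v + b) * (t%:R + s%:R) <= (v + b) * i%:R.
      by rewrite ler_wpM2l; [|lra|rewrite -natrD ler_nat].
    lra.
  have := Hh _ (mulr_gt0 i0 M0) (decay i M cM).
  rewrite lnM ?posrE// expRK natrX lnXn ?ltr0n//.
  have := lnlin i.+1%:R (ltr0Sn _ i); rewrite -[X in _ * X]natr1.
  have -> : e / 2 = 5 * b by rewrite /b; lra.
  have := vlo i; rewrite /K2 -mulr_natl; lra.
near=> i.
have i0 : 0 < i%:R :> R by rewrite ltr0n; near: i; exists 1%N.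
have K2i : K2 <= e / 2 * i%:R.
  have : 2 * `|K2| / e <= i%:R by near: i; apply: nbhs_infty_ger.
  by rewrite ler_pdivrMr// => ?; have := ler_norm K2; lra.
rewrite /=; have [h [l [-> -> [h0 l0 li] hvl Hh]]] := walk i.
have low := lower i h Hh; rewrite /= distrC ler_distl.
(* If [l = 0], then [h <= v * l] forces [h = 0], the quotient is 0 by convention, and the lower
   bound on [h] gives [v <= e]. *)
have [l_eq0|l_neq0] := eqVneq l 0.
  have h_eq0 : h = 0 by apply/le_anti; rewrite h0 andbT; move: hvl; rewrite l_eq0 mulr0.
  rewrite h_eq0 mul0r; apply/andP; split; last lra.
  rewrite h_eq0 in low; rewrite leNgt; apply/negP => ve.
  have : 0 < (v - e) * i%:R by rewrite mulr_gt0.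
  lra.
have {}l0 : 0 < l by rewrite lt_neqAle eq_sym l_neq0.
apply/andP; split; last by rewrite ler_pdivrMr//; have := mulr_gt0 e0 l0; lra.
(* Replacing [i] by [l <= i] in [(v - e) * i <= h] requires [v - e] to be nonnegative; otherwise
   [h / l >= 0] suffices. *)
have [ve|ve] := leP (v - e) 0; first by rewrite (le_trans ve)// divr_ge0// ltW.
have := ler_wpM2l (ltW ve) li; rewrite ler_pdivlMr//; lra.
Unshelve. all: by end_near. Qed.
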